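(* Let $\mathcal{X}$ be a linear space over $\mathbb{K}$ ($\mathbb{K}=\mathbb{R}$ or $\mathbb{C}$), and let $R,S$ be linear relations in $\mathcal{X}$. The following are equivalent: (i) there exists a projection $Q$ in $\mathcal{X}$ such that $R=SQ$; (ii) $\operatorname{dom} R=\{x: S(x)=R(x)\}+\ker R$ and $\operatorname{mul} R=\operatorname{mul} S$. Here $\{x: S(x)=R(x)\}$ denotes the set of $x\in\operatorname{dom} S\cap\operatorname{dom} R$ with $S(x)=R(x)$.
   Context: A linear relation in $\mathcal{X}$ is a linear subspace $T$ of $\mathcal{X}\times\mathcal{X}$. Write $\operatorname{dom}T=\{x:\exists y,\ (x,y)\in T\}$, $\operatorname{ran}T=\{y:\exists x,\ (x,y)\in T\}$, $\ker T=\{x:(x,0)\in T\}$, $\operatorname{mul}T=\{y:(0,y)\in T\}$, and, for $x\in\operatorname{dom}T$, $T(x)=\{y:(x,y)\in T\}$. The product of linear relations is $ST=\{(x,z): (x,y)\in T \text{ and } (y,z)\in S\text{ for some }y\}$, and equality of relations is equality of subspaces. A projection in $\mathcal{X}$ is a linear relation $Q$ in $\mathcal X$ with $Q^2=Q$, $\operatorname{ran}Q\subseteq\operatorname{dom}Q$ and $\operatorname{mul}Q=\{0\}$; equivalently $Q=\{(m+n,m):m\in\mathcal{M},n\in\mathcal{N}\}$ for subspaces $\mathcal{M},\mathcal{N}$ of $\mathcal{X}$ with $\mathcal{M}\cap\mathcal{N}=\{0\}$ (its domain $\mathcal{M}+\mathcal{N}$ need not be all of $\mathcal{X}$). *)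

(* Defs.v *)
From HB Require Import structures.
From mathcomp Require Import all_boot all_order all_algebra.
From mathcomp Require Import all_classical all_reals.
From mathcomp Require Import complex.

Set Implicit Arguments.
Unset Strict Implicit.
Unset Printing Implicit Defensive.

Import Order.TTheory GRing.Theory Num.Theory.
Local Open Scope classical_set_scope.
Local Open Scope ring_scope.

Variant scalar_kind := RealScalars | ComplexScalars.

Definition scalars (F : realType) (k : scalar_kind) : fieldType :=
  match k with
  | RealScalars => F
  | ComplexScalars => F[i]
  end.

Section LinearRelations.
Variables (K : fieldType) (X : lmodType K).
Implicit Types S T Q : set (X * X).

Definition linear_relation T : Prop :=
  GRing.submod_closed (mem T : {pred (X * X)%type}).

Definition reldom T : set X := T.`1.

Definition relran T : set X := T.`2.

Definition relker T : set X := [set x | T (x, 0)].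

Definition relmul T : set X := [set y | T (0, y)].

Definition image_at T (x : X) : set X := [set y | T (x, y)].

(* In [relation_scope], [S \; T] applies [T] first. *)
Definition relprod S T : set (X * X) := (S \; T)%relation.

Definition projection Q : Prop :=
  [/\ linear_relation Q, relprod Q Q = Q, relran Q `<=` reldom Q
    & relmul Q = [set 0]].

(* Both values are empty when [x] lies in neither domain, hence the explicit
   restriction to the domains. *)
Definition agreement S T : set X :=
  [set x | [/\ reldom S x, reldom T x & image_at S x = image_at T x]].

Definition sumset (A B : set X) : set X := [set x + y | x in A & y in B].

End LinearRelations.

(* Main.v *)
Require Import Defs.
From mathcomp Require Import all_boot all_order all_algebra.
From mathcomp Require Import all_classical all_reals.
Import GRing.Theory.
Local Open Scope classical_set_scope.
Local Open Scope ring_scope.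

(** If [R = SQ], every [x] in [dom R] lies in [dom Q] and splits as
    [x = m + n] with [m = Q x] in [ran Q] and [n] in [ker Q].  On [ran Q] the
    relation [SQ] is [S] itself, so [m] belongs to the agreement set of [S]
    and [R], while [n] is sent to [S 0], so [n] belongs to [ker R].  As [Q] is
    single-valued, [mul (SQ) = mul S].

    Conversely, two relations with the same multivalued part agree at [x] as
    soon as they have one common value there, because each value set is a
    translate of the multivalued part.  Hence, if [mul R = mul S], the agreement set
    [A] is the domain of the intersection of [R] and [S], a subspace
    ([agreementE]).  It may meet [ker R]; so [A] is first replaced by a
    subspace [M] of [A] that is independent of [ker R] and has the same sum
    with it, which exists by Zorn's lemma ([independent_subspace]).  The
    projection [Q] with range [M] and kernel [ker R] then works: [S] and [R]
    have the same values at the points of [M], and these are also the values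
    of [R] at [m + n] for [n] in [ker R]. *)

Section LinearRelationFactorization.
Set Implicit Arguments.
Unset Strict Implicit.
Variables (K : fieldType) (X : lmodType K).
Implicit Types (Q R S T : set (X * X)) (M N : set X).

Definition subspace (V : lmodType K) (U : set V) : Prop :=
  U 0 /\ forall a u v, U u -> U v -> U (a *: u + v).

Lemma linear_relationP T : linear_relation T <-> subspace T.
Proof.
split=> -[T0 Tlin]; split; first exact: set_mem T0.
- by move=> a u v Tu Tv; apply: set_mem; apply: Tlin; exact: mem_set.
- exact: mem_set T0.
- by move=> a u v /set_mem Tu /set_mem Tv; apply/mem_set/Tlin.
Qed.

Lemma subspaceD (V : lmodType K) (U : set V) u v :
  subspace U -> U u -> U v -> U (u + v).
Proof. by move=> [_ Ulin] Uu Uv; rewrite -[u]scale1r; exact: Ulin. Qed.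

Lemma subspaceB (V : lmodType K) (U : set V) u v :
  subspace U -> U u -> U v -> U (u - v).
Proof. by move=> [_ Ulin] Uu Uv; rewrite addrC -scaleN1r; exact: Ulin. Qed.

Lemma subspace_setI (V : lmodType K) (U W : set V) :
  subspace U -> subspace W -> subspace (U `&` W).
Proof.
move=> [U0 Ulin] [W0 Wlin]; split=> // a u v [Uu Wu] [Uv Wv].
by split; [exact: Ulin | exact: Wlin].
Qed.

Lemma subspace_reldom T : subspace T -> subspace (reldom T).
Proof.
move=> [T0 Tlin]; split=> [|a u v [y Tuy] [z Tvz]]; first by exists 0.
by exists (a *: y + z); exact: Tlin Tuy Tvz.
Qed.

Lemma subspace_relker T : subspace T -> subspace (relker T).
Proof.
move=> [T0 Tlin]; split=> // a u v Tu Tv.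
by have := Tlin a _ _ Tu Tv; rewrite /relker /= -[a *: _]/(_, a *: 0) scaler0
  -[(_, _) + _]/(_, 0 + 0) addr0.
Qed.

(** The set [M] is a maximal linearly closed subset of [A] meeting [N] only at
    [0]: a vector [v] of [A] outside [N + M] could be added to [M], since
    [a *: v + c \in N] with [a != 0] would give [v \in N + M]. *)
Lemma independent_subspace (A N : set X) : subspace A -> subspace N ->
  exists M, [/\ subspace M, M `<=` A, M `&` N `<=` [set 0]
              & A `<=` sumset M N].
Proof.
move=> [A0 Alin] Nsub; have [N0 Nlin] := Nsub.
(* Membership of 0 is left out of [P], so that the union of the empty chain
   satisfies [P]. *)
pose P M := [/\ forall a u v, M u -> M v -> M (a *: u + v), M `<=` A
              & M `&` N `<=` [set 0]].
have [F FP Ftot|M [[Mlin MA MN] Mmax]] := @Zorn_bigcup X P.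
  split=> [a u v [U FU Uu] [W FW Wv]|x [U FU Ux]|x [[U FU Ux] Nx]].
  - have [UW|WU] := Ftot _ _ FU FW.
      by exists W => //; have [Wlin _ _] := FP _ FW; apply: Wlin => //; exact: UW.
    by exists U => //; have [Ulin _ _] := FP _ FU; apply: Ulin => //; exact: WU.
  - by have [_ UA _] := FP _ FU; exact: UA.
  - by have [_ _ UN] := FP _ FU; exact: UN.
have M0 : M 0.
  apply: contrapT => nM0; apply: (Mmax (M `|` [set 0])).
    by split=> [x Mx|/(_ 0 (or_intror erefl))]; first left.
  split=> [a u v [Mu|->] [Mv|->]|x [/MA//|->//]|x [[Mx|->//] Nx]].
  - by left; exact: Mlin.
  - case: (nM0); rewrite -(subrr u) addrC -scaleN1r; exact: Mlin.
  - by rewrite scaler0 add0r; left.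
  - by rewrite scaler0 addr0; right.
  - exact: MN.
have Msub : subspace M by [].
exists M; split=> // v Av; apply: contrapT => nMNv.
apply: (Mmax [set a *: v + c | a in setT & c in M]).
  split=> [c Mc|MvM]; first by exists 0 => //; exists c => //; rewrite scale0r add0r.
  apply: nMNv; exists v; last by exists 0; rewrite ?addr0.
  by apply: MvM; exists 1 => //; exists 0 => //; rewrite scale1r addr0.
split=> [b _ _ [a1 _ [c1 Mc1 <-]] [a2 _ [c2 Mc2 <-]]|_ [a _ [c Mc <-]]
        |_ [[a _ [c Mc <-]] Nx]].
- exists (b * a1 + a2) => //; exists (b *: c1 + c2); first exact: Mlin.
  by rewrite scalerDl scalerDr scalerA addrACA.
- by apply: Alin => //; exact: MA.
- have [a0|an0] := eqVneq a 0.
    by move: Nx; rewrite a0 scale0r add0r => Nc; exact: MN.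
  case: nMNv; exists ((- a^-1) *: c).
    by rewrite -[_ *: _]addr0; exact: Mlin.
  exists (a^-1 *: (a *: v + c)).
    by rewrite -[_ *: _]addr0; exact: Nlin.
  by rewrite scalerDr scalerA mulVf // scale1r scaleNr addrCA addNr addr0.
Qed.

(** The value of [T] at [x] is the coset [z + mul T]. *)
Lemma relval_translate T x y z : subspace T -> T (x, z) ->
  T (x, y) <-> relmul T (y - z).
Proof.
move=> Tsub Txz; split=> [Txy|Tyz].
  by have := subspaceB Tsub Txy Txz; rewrite -[_ - _]/(x - x, y - z) subrr.
by have := subspaceD Tsub Tyz Txz;
  rewrite -[_ + _]/(0 + x, y - z + z) add0r subrK.
Qed.

Lemma agreementE R S : subspace R -> subspace S -> relmul R = relmul S ->
  agreement S R = reldom (R `&` S).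
Proof.
move=> Rsub Ssub mulRS; apply/seteqP; split=> [x [[y Sxy] _ SR]|x [z [Rxz Sxz]]].
  by exists y; split=> //; rewrite -[R _]/(image_at R x y) -SR.
split; [by exists z|by exists z|apply/seteqP; split=> y /=] => Txy.
  by apply/(relval_translate _ Rsub Rxz); rewrite mulRS;
    apply/(relval_translate _ Ssub Sxz).
by apply/(relval_translate _ Ssub Sxz); rewrite -mulRS;
  apply/(relval_translate _ Rsub Rxz).
Qed.

(** The relation of all pairs [(m + n, m)] with [m] in [M] and [n] in [N]. It
    is written as a condition on a pair so that linearity is checked
    coordinatewise. *)
Definition projection_onto_along M N : set (X * X) :=
  [set p | M p.2 /\ N (p.1 - p.2)].

Lemma projection_onto_alongP M N : subspace M -> subspace N ->
  M `&` N `<=` [set 0] -> projection (projection_onto_along M N).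
Proof.
move=> Msub Nsub MN; have [[M0 Mlin] [N0 Nlin]] := (Msub, Nsub).
split.
- apply/linear_relationP; split=> [|a [x m] [y n] [/= Mm Nxm] [/= Mn Nyn]].
    by split=> //=; rewrite subr0.
  split=> /=; first exact: Mlin.
  by rewrite opprD addrACA -scalerBr; exact: Nlin.
- apply/seteqP; split=> [[x z] [y [/= My Nxy] [/= Mz Nyz]]|[x y] [/= My Nxy]].
    by split=> //=; rewrite -(subrKA y); exact: subspaceD.
  by exists y; split=> //=; rewrite subrr.
- by move=> m [x [/= Mm _]]; exists m; split=> //=; rewrite subrr.
- apply/seteqP; split=> [m [/= Mm]|_ ->]; last by split=> //=; rewrite subr0.
  rewrite sub0r => Nm; apply: MN; split=> //.
  by rewrite -[m]opprK -sub0r; exact: subspaceB.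
Qed.

Lemma relmul_relprod S Q : relmul Q = [set 0] -> relmul (relprod S Q) = relmul S.
Proof.
move=> mulQ; apply/seteqP; split=> [z [y /= Q0y Syz]|z Sz].
  by have : relmul Q y by []; rewrite mulQ => yE; move: Syz; rewrite yE.
by exists 0 => //; rewrite -[Q _]/(relmul Q 0) mulQ.
Qed.

Lemma projection_single_valued Q x y z :
  projection Q -> Q (x, y) -> Q (x, z) -> z = y.
Proof.
move=> [/linear_relationP Qsub _ _ mulQ] Qxy.
by move/(relval_translate _ Qsub Qxy); rewrite mulQ => /subr0_eq.
Qed.

(** [Q^2 = Q] factors [(x, y)] through some [(x, w)] and [(w, y)], and [w = y]
    because [Q] is single-valued. *)
Lemma projection_fix Q x y : projection Q -> Q (x, y) -> Q (y, y).
Proof.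
move=> Qproj Qxy; have [_ QQ _ _] := Qproj.
have [w /= Qxw Qwy] : relprod Q Q (x, y) by rewrite QQ.
by rewrite -{1}(projection_single_valued Qproj Qxy Qxw).
Qed.

(** The splitting [x = Q x + (x - Q x)] works: [Q] fixes [Q x], so [SQ] and [S]
    agree there, and [Q] kills [x - Q x]. *)
Lemma reldom_relprod_projection S Q : subspace S -> projection Q ->
  subspace (relprod S Q) ->
  reldom (relprod S Q)
  = sumset (agreement S (relprod S Q)) (relker (relprod S Q)).
Proof.
move=> [S0 _] Qproj SQsub; have [/linear_relationP Qsub _ _ _] := Qproj.
apply/seteqP; split=> [x [z [y /= Qxy Syz]]|_ [a [_ Ra _]] [n SQn <-]]; last first.
  by apply: subspaceD (subspace_reldom SQsub) Ra _; exists 0.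
have Qyy := projection_fix Qproj Qxy.
exists y.
  split; [by exists z|by exists z, y|apply/seteqP; split=> w /=].
    by exists y.
  by move=> [u /= Qyu Suw]; rewrite -(projection_single_valued Qproj Qyy Qyu).
exists (x - y); last by rewrite addrC subrK.
exists 0 => //=.
by have := subspaceB Qsub Qxy Qyy; rewrite -[_ - _]/(x - y, y - y) subrr.
Qed.

(** Subtracting a vector of [ker R] from [x] leaves its [R]-values unchanged, so
    [R] is determined by its values on [M], where they are those of [S]. *)
Lemma relprod_projection_onto_along R S M : subspace R ->
  M `<=` agreement S R -> reldom R `<=` sumset M (relker R) ->
  R = relprod S (projection_onto_along M (relker R)).
Proof.
move=> Rsub MA domR; apply/seteqP; split=> [[x z] Rxz|[x z] [m [/= Mm Rxm] Smz]].
  have [|m Mm [n Rn xE]] := domR x; first by exists z.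
  have [_ _ SRm] := MA _ Mm; subst x.
  exists m; first by split=> //=; rewrite addrAC subrr add0r.
  rewrite -[S _]/(image_at S m z) SRm.
  by have := subspaceB Rsub Rxz Rn;
    rewrite -[_ - _]/(m + n - n, z - 0) addrK subr0.
have [_ _ SRm] := MA _ Mm.
have Rmz : R (m, z) by rewrite -[R _]/(image_at R m z) -SRm.
by have := subspaceD Rsub Rxm Rmz; rewrite -[_ + _]/(x - m + m, 0 + z) subrK add0r.
Qed.

Lemma projection_factorization R S : subspace R -> subspace S ->
  (exists Q, projection Q /\ R = relprod S Q) <->
  (reldom R = sumset (agreement S R) (relker R) /\ relmul R = relmul S).
Proof.
move=> Rsub Ssub; split=> [[Q [Qproj RE]]|[domR mulRS]].
  subst R; have [_ _ _ mulQ] := Qproj.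
  by split; [exact: reldom_relprod_projection | exact: relmul_relprod].
have Nsub := subspace_relker Rsub.
have [|M [Msub MA MN AMN]] := @independent_subspace (agreement S R) _ _ Nsub.
  by rewrite agreementE //; exact/subspace_reldom/subspace_setI.
exists (projection_onto_along M (relker R)); split.
  exact: projection_onto_alongP.
apply: relprod_projection_onto_along => // x.
rewrite domR => -[a /AMN[m Mm [n Nn <-]] [n' Nn' <-]].
exists m => //; exists (n + n'); first exact: subspaceD.
exact: addrA.
Qed.

End LinearRelationFactorization.

Theorem theorem5p4 (F : realType) (k : scalar_kind)
    (X : lmodType (scalars F k)) (R S : set (X * X))
    (hR : linear_relation R) (hS : linear_relation S) :
  (exists Q : set (X * X), projection Q /\ R = relprod S Q) <->
  (reldom R = sumset (agreement S R) (relker R) /\ relmul R = relmul S).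
Proof. by apply: projection_factorization; exact/linear_relationP. Qed.
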